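(* Let $\lambda>0$, $\lambda_g>0$, and consider the linear model $y=X\beta^*+\varepsilon$ with deterministic design $X\in\mathbb{R}^{N\times n}$ and $\beta^*\in\mathcal{S}(k,q_1,q_2,R_1,R_2)$. Assume that there exist a curvature $\eta'_\gamma>0$ and a tolerance $\tau(N,n)>0$ such that $$\frac1N\|XD^{+}v\|_2^2\ge\eta'_\gamma\|v\|_2^2-\tau(N,n)\|v\|_1^2\quad\text{for all }v\in\mathbb{R}^{m+n},$$ and that $\lambda\ge\frac2N\|\varepsilon^TXD^{+}\|_\infty$. Furthermore, assume there exist constants $\eta_1>0$ and $\eta_2>0$ such that $$R_1\eta_1^{-q_1}+R_2\eta_2^{-q_2}\le\frac{\eta'_\gamma}{64\,\tau(N,n)} .$$ Let $\hat\beta$ be the $k$-th order Graph-Piecewise-Polynomial-Lasso with tuning parameters $\lambda,\lambda_g$, and set $$\mathrm{I}=\frac{144\lambda^2\left(R_1\eta_1^{-q_1}+R_2\eta_2^{-q_2}\right)}{(\eta'_\gamma)^2},$$ $$\mathrm{II}=\frac{32}{\eta'_\gamma}\left[\lambda_gR_1\eta_1^{1-q_1}+\lambda R_2\eta_2^{1-q_2}+4\tau(N,n)\left(\frac{\lambda_g}{\lambda}R_1\eta_1^{1-q_1}+R_2\eta_2^{1-q_2}\right)^2\right].$$ (a) Then $\|\hat\beta-\beta^*\|_2^2\le \mathrm{I}+\mathrm{II}$ and $$\frac1N\|X(\hat\beta-\beta^* )\|_2^2\le4\left(\lambda_gR_1\eta_1^{1-q_1}+\lambda R_2\eta_2^{1-q_2}\right)+3\lambda\sqrt{\left(R_1\eta_1^{-q_1}+R_2\eta_2^{-q_2}\right)\left(\mathrm{I}+\mathrm{II}\right)}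 .$$ (b) If $\lambda_g=2^{-(1+k/2)}d^{-(k+1)/2}\lambda$, where $d$ is the maximum degree of the underlying graph, then $$\|\hat\beta-\beta^*\|_1^2\le128\left(\frac{\lambda_g}{\lambda}R_1\eta_1^{1-q_1}+R_2\eta_2^{1-q_2}\right)^2+128\left(R_1\eta_1^{-q_1}+R_2\eta_2^{-q_2}\right)\left(\mathrm{I}+\mathrm{II}\right).$$
   Context: Graph: $\mathcal{G}=(\mathcal{V},\mathcal{E})$ is a known undirected graph with $n$ nodes labelled $1,\dots,n$, $p$ edges, and maximum degree $d$. Its oriented incidence matrix $F\in\{-1,0,1\}^{p\times n}$ has, for the row corresponding to the edge $(i,j)$ with $i<j$, entry $-1$ in position $i$, $+1$ in position $j$, and $0$ elsewhere. The Laplacian is $L=F^TF$. Graph difference operators: $\Delta^{(1)}=F$, and for $k\ge1$, $\Delta^{(k+1)}=F^T\Delta^{(k)}=L^{(k+1)/2}$ if $k$ is odd, $\Delta^{(k+1)}=F\Delta^{(k)}=FL^{k/2}$ if $k$ is even. $k\ge0$ is a fixed integer and $m$ is the number of rows of $\Delta^{(k+1)}$ ($m=n$ for odd $k$, $m=p$ for even $k$). Parameter space: for $k\ge0$, $0<q_1<1$, $0<q_2<1$, $R_1>0$, $R_2>0$, $$\mathcal{S}(k,q_1,q_2,R_1,R_2)=\left\{\beta\in\mathbb{R}^n:\ \sum_{i=1}^m\left|(\Delta_i^{(k+1)})^T\beta\right|^{q_1}\le R_1,\ \sum_{i=1}^n|\beta_i|^{q_2}\le R_2\right\},$$ where $(\Delta_i^{(k+1)})^T$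 is the $i$-th row of $\Delta^{(k+1)}$. Model: $y\in\mathbb{R}^N$ and $\varepsilon\in\mathbb{R}^N$ has i.i.d. $\sigma_\varepsilon$-sub-Gaussian components (mean zero, moment generating function at most $e^{\sigma_\varepsilon^2t^2/2}$ for all $t\in\mathbb{R}$). Estimator: the $k$-th order Graph-Piecewise-Polynomial-Lasso is $$\hat\beta\in\arg\min_{\beta\in\mathbb{R}^n}\ \frac1{2N}\|y-X\beta\|_2^2+\lambda_g\|\Delta^{(k+1)}\beta\|_1+\lambda\|\beta\|_1 .$$ Let $\gamma=\lambda_g/\lambda$, $D=\begin{bmatrix}\frac{\lambda_g}{\lambda}\Delta^{(k+1)}\\ I_n\end{bmatrix}\in\mathbb{R}^{(m+n)\times n}$, and $D^{+}=(D^TD)^{-1}D^T\in\mathbb{R}^{n\times(m+n)}$. $\|\cdot\|_\infty$ is the entrywise maximum absolute value. *)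

(* Defs.v *)
From HB Require Import structures.
From mathcomp Require Import all_boot all_order all_algebra.
From mathcomp Require Import all_classical all_reals all_analysis.

Set Implicit Arguments.
Unset Strict Implicit.
Unset Printing Implicit Defensive.

Import Order.TTheory GRing.Theory Num.Theory.
Import numFieldNormedType.Exports.

Local Open Scope classical_set_scope.
Local Open Scope ring_scope.

Definition norm1 (R : realType) (r : nat) (v : 'cV[R]_r) : R :=
  \sum_(i < r) `|v i 0|.

Definition norm2 (R : realType) (r : nat) (v : 'cV[R]_r) : R :=
  Num.sqrt (\sum_(i < r) v i 0 ^+ 2).

(* A graph on the nodes 'I_n is given by its adjacency relation adj, assumed
   symmetric and irreflexive where it is used. Each undirected edge is
   represented once, by the pair (i, j) with i < j. *)
Definition edges (n : nat) (adj : rel 'I_n) : {set 'I_n * 'I_n} :=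
  [set ij : 'I_n * 'I_n | (ij.1 < ij.2)%N && adj ij.1 ij.2].

Definition max_degree (n : nat) (adj : rel 'I_n) : nat :=
  \max_(i < n) #|[pred j | adj i j]|.

Section GraphDifference.
Context (R : realType) (n : nat) (adj : rel 'I_n).

Definition incidence : 'M[R]_(#|edges adj|, n) :=
  \matrix_(l, v) (if v == (enum_val l).1 then -1
                  else if v == (enum_val l).2 then 1 else 0).

Definition laplacian : 'M[R]_n := incidence^T *m incidence.

(* gdiff k is the difference operator of order k + 1; its height is n for odd
   k and the number of edges for even k. *)
Definition gdiff_rows_parity (b : bool) : nat := if b then n else #|edges adj|.

Definition gdiff_rows (k : nat) : nat := gdiff_rows_parity (odd k).

(* Multiplication by F when the height is n, by its transpose when the height is
   #|edges adj|. *)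
Definition gdiff_step (b : bool) :
    'M[R]_(gdiff_rows_parity b, n) -> 'M[R]_(gdiff_rows_parity (~~ b), n) :=
  if b as b0
    return 'M[R]_(gdiff_rows_parity b0, n) ->
           'M[R]_(gdiff_rows_parity (~~ b0), n)
  then fun M => incidence *m M else fun M => incidence^T *m M.

Fixpoint gdiff (k : nat) : 'M[R]_(gdiff_rows k, n) :=
  if k is k'.+1 then gdiff_step (gdiff k') else incidence.

Definition gdiff_closed (b : bool) (h : nat) : 'M[R]_(gdiff_rows_parity b, n) :=
  if b as b0 return 'M[R]_(gdiff_rows_parity b0, n)
  then laplacian ^+ h.+1 else incidence *m laplacian ^+ h.

Lemma gdiff_step_closed (b : bool) (h : nat) :
  gdiff_step (gdiff_closed b h) = gdiff_closed (~~ b) (b + h).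
Proof. by case: b => //=; rewrite mulmxA exprS. Qed.

(* L^((k+1)/2) for odd k and F L^(k/2) for even k, both with h = k / 2. *)
Lemma gdiffE (k : nat) : gdiff k = gdiff_closed (odd k) k./2.
Proof.
elim: k => [|k IHk]; first by rewrite /= expr0 mulmx1.
transitivity (gdiff_step (gdiff_closed (odd k) k./2)).
  by rewrite -IHk.
by rewrite gdiff_step_closed -uphalf_half.
Qed.

End GraphDifference.

Definition param_space (R : realType) (n : nat) (adj : rel 'I_n) (k : nat)
    (q1 q2 R1 R2 : R) : set 'cV[R]_n :=
  [set beta | \sum_(i < gdiff_rows adj k)
                `|(row i (gdiff R adj k) *m beta) 0 0| `^ q1 <= R1 /\
              \sum_(i < n) `|beta i 0| `^ q2 <= R2].

Definition gppl_objective (R : realType) (n : nat) (adj : rel 'I_n) (k N : nat)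
    (X : 'M[R]_(N, n)) (y : 'cV[R]_N) (lamg lam : R) (beta : 'cV[R]_n) : R :=
  (2 * N%:R)^-1 * norm2 (y - X *m beta) ^+ 2
  + lamg * norm1 (gdiff R adj k *m beta) + lam * norm1 beta.

Definition is_gppl (R : realType) (n : nat) (adj : rel 'I_n) (k N : nat)
    (X : 'M[R]_(N, n)) (y : 'cV[R]_N) (lamg lam : R) (betahat : 'cV[R]_n) : Prop :=
  forall beta : 'cV[R]_n,
    gppl_objective adj k X y lamg lam betahat
      <= gppl_objective adj k X y lamg lam beta.

Definition stacked_op (R : realType) (n : nat) (adj : rel 'I_n) (k : nat)
    (lamg lam : R) : 'M[R]_(gdiff_rows adj k + n, n) :=
  col_mx ((lamg / lam) *: gdiff R adj k) 1%:M.

Definition left_pinv (R : realType) (r n : nat) (D : 'M[R]_(r, n)) :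
    'M[R]_(n, r) :=
  invmx (D^T *m D) *m D^T.

Section Noise.
Context (d : measure_display) (T : measurableType d) (R : realType)
  (P : probability T R) (N : nat).

Definition mutually_independent (eps : 'I_N -> {RV P >-> R}) : Prop :=
  forall (J : {set 'I_N}) (B : 'I_N -> set R),
    (forall i, measurable (B i)) ->
    P (\bigcap_(i in [set` J]) eps i @^-1` B i)
    = (\prod_(i in J) P (eps i @^-1` B i))%E.

Definition identically_distributed (eps : 'I_N -> {RV P >-> R}) : Prop :=
  forall (i j : 'I_N) (B : set R), measurable B ->
    distribution P (eps i) B = distribution P (eps j) B.

Definition sub_gaussian (sigma : R) (Z : {RV P >-> R}) : Prop :=
  ('E_P[Z] = 0)%E /\
  forall t : R, ('M_ P Z t <= (expR (sigma ^+ 2 * t ^+ 2 / 2))%:E)%E.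

Definition noise_vector (eps : 'I_N -> {RV P >-> R}) (w : T) : 'cV[R]_N :=
  \col_i eps i w.

End Noise.

(* Main.v *)
Require Import Defs.
From HB Require Import structures.
From mathcomp Require Import all_boot all_order all_algebra.
From mathcomp Require Import all_classical all_reals all_analysis.
From mathcomp Require Import ring lra.

Set Implicit Arguments.
Unset Strict Implicit.
Unset Printing Implicit Defensive.

Import Order.TTheory GRing.Theory Num.Theory.
Import numFieldNormedType.Exports.

Local Open Scope classical_set_scope.
Local Open Scope ring_scope.

(** The penalty equals lam times the l1 norm of D beta, where D stacks
    (lamg / lam) times the graph difference operator on top of the identity.
    The problem is therefore an ordinary Lasso in the analysis coordinates
    D beta: as left_pinv D is a left inverse of D, the error nu = betahat - betas
    satisfies X nu = X (left_pinv D) v with v = D nu, and both the curvature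
    hypothesis and the noise hypothesis are about the design X (left_pinv D).

    Optimality of betahat and the choice of lam give the basic inequality
    ([analysis_lasso_basic])
<<
      N^-1 |X nu|_2^2 <= lam (|v|_1 + 2 (|D betas|_1 - |D betahat|_1)).
>>
    Let S be the set of the coordinates where a row of the difference operator
    applied to betas exceeds eta1, or an entry of betas exceeds eta2. Weak
    sparsity bounds the cardinal of S by s = R1 eta1^(-q1) + R2 eta2^(-q2), and
    the l1 mass of D betas off S by
    a = (lamg / lam) R1 eta1^(1 - q1) + R2 eta2^(1 - q2)
    ([card_above], [sum_below]). The right-hand side above is then at most
    lam (3 |v_S|_1 - |v_S^c|_1 + 4 a) ([norm1_decomposable]). As the left-hand
    side is nonnegative, v lies in an approximate cone, where
    |v|_1 <= 4 |v_S|_1 + 4 a, and |v_S|_1^2 <= s |v|_2^2 by Cauchy-Schwarz. The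
    tolerance term of the curvature hypothesis is then absorbed thanks to
    64 tau s <= eta', which leaves a quadratic inequality in |v|_2
    ([lasso_error_arith]). Finally D contains the identity as a block, so the l1
    and l2 norms of nu are at most those of v. *)

(** * Weakly sparse vectors *)

(** Cauchy-Schwarz against the indicator function of S. *)
Lemma sqr_sum_le_card (R : realFieldType) (I : finType) (S : {set I})
    (f : I -> R) :
  (\sum_(i in S) f i) ^+ 2 <= #|S|%:R * \sum_(i in S) f i ^+ 2.
Proof.
set t := \sum_(i in S) f i; set Q := \sum_(i in S) f i ^+ 2.
case: (posnP #|S|) => [/eqP|S_gt0].
  rewrite cards_eq0 => /eqP S0.
  by rewrite /t /Q S0 !big_set0 expr0n mulr0.
have m_gt0 : 0 < #|S|%:R :> R by rewrite ltr0n.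
(* up to the factor m^2, with m the cardinal of S, the sum of the squared
   deviations of f from its mean on S *)
have : 0 <= \sum_(i in S) (#|S|%:R * f i - t) ^+ 2.
  by apply: sumr_ge0 => i _; exact: sqr_ge0.
have -> : \sum_(i in S) (#|S|%:R * f i - t) ^+ 2 =
    #|S|%:R * (#|S|%:R * Q - t ^+ 2).
  transitivity (\sum_(i in S)
      (#|S|%:R ^+ 2 * f i ^+ 2 - 2 * #|S|%:R * t * f i + t ^+ 2)).
    by apply: eq_bigr => i _; ring.
  rewrite big_split sumrB /= -!mulr_sumr -/t -/Q sumr_const -mulr_natl.
  by ring.
by rewrite pmulr_rge0// subr_ge0.
Qed.

Definition above (R : realType) (I : finType) (eta : R) (u : I -> R) : {set I} :=
  [set i | eta < `|u i|]%SET.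

Section Threshold.
Context (R : realType) (I : finType) (u : I -> R) (q B eta : R).
Hypotheses (q01 : 0 < q < 1) (eta_gt0 : 0 < eta)
  (uB : \sum_i `|u i| `^ q <= B).

(** Markov's inequality for the q-th power. *)
Lemma card_above : #|above eta u|%:R <= B * eta `^ (- q).
Proof.
have [q_gt0 _] := andP q01.
rewrite powRN ler_pdivlMr ?powR_gt0//; apply: le_trans uB.
rewrite (bigID (mem (above eta u))) /= mulr_natl -sumr_const.
rewrite -[leLHS]addr0; apply: lerD; last first.
  by apply: sumr_ge0 => i _; exact: powR_ge0.
apply: ler_sum => i; rewrite inE => ui.
by apply: (ge0_ler_powR (ltW q_gt0)); rewrite ?nnegrE// ltW.
Qed.

(** Below the threshold, |u i| = |u i|^q |u i|^(1-q) <= |u i|^q eta^(1-q). *)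
Lemma sum_below :
  \sum_(i | i \notin above eta u) `|u i| <= B * eta `^ (1 - q).
Proof.
have [q_gt0 q_lt1] := andP q01.
apply: (@le_trans _ _ ((\sum_i `|u i| `^ q) * eta `^ (1 - q))); last first.
  by rewrite ler_wpM2r ?powR_ge0.
rewrite [in leRHS](bigID (mem (above eta u))) /= mulrDl mulr_suml.
rewrite -[leLHS]add0r; apply: lerD.
  by apply: sumr_ge0 => i _; rewrite mulr_ge0 ?powR_ge0.
rewrite mulr_suml; apply: ler_sum => i; rewrite inE -leNgt => ui.
rewrite -[leLHS]powRr1// -[X in _ `^ X](subrKC q).
rewrite powRD ?subrKC ?oner_eq0// ler_wpM2l ?powR_ge0//.
by apply: ge0_ler_powR; rewrite ?nnegrE// ?subr_ge0 ltW.
Qed.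

End Threshold.

(** * Norms and the left inverse of the stacked operator *)

Section Norms.
Context (R : realType).

Lemma sqr_norm2 (r : nat) (v : 'cV[R]_r) :
  norm2 v ^+ 2 = \sum_(i < r) v i 0 ^+ 2.
Proof. by rewrite sqr_sqrtr// sumr_ge0// => i _; exact: sqr_ge0. Qed.

Lemma norm1_ge0 (r : nat) (v : 'cV[R]_r) : 0 <= norm1 v.
Proof. by apply: sumr_ge0. Qed.

Lemma norm1_col_mx (r1 r2 : nat) (u : 'cV[R]_r1) (v : 'cV[R]_r2) :
  norm1 (col_mx u v) = norm1 u + norm1 v.
Proof.
rewrite /norm1 big_split_ord /=.
by congr (_ + _); apply: eq_bigr => i _; rewrite (col_mxEu, col_mxEd).
Qed.

Lemma sqr_norm2_col_mx (r1 r2 : nat) (u : 'cV[R]_r1) (v : 'cV[R]_r2) :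
  norm2 (col_mx u v) ^+ 2 = norm2 u ^+ 2 + norm2 v ^+ 2.
Proof.
rewrite !sqr_norm2 big_split_ord /=.
by congr (_ + _); apply: eq_bigr => i _; rewrite (col_mxEu, col_mxEd).
Qed.

Lemma norm1Z (r : nat) (c : R) (v : 'cV[R]_r) : norm1 (c *: v) = `|c| * norm1 v.
Proof.
by rewrite /norm1 mulr_sumr; apply: eq_bigr => i _; rewrite mxE normrM.
Qed.

Lemma sqr_norm2B (r : nat) (u v : 'cV[R]_r) :
  norm2 (u - v) ^+ 2 = norm2 u ^+ 2 - 2 * (u^T *m v) 0 0 + norm2 v ^+ 2.
Proof.
rewrite !sqr_norm2 mxE mulr_sumr -sumrB -big_split /=.
by apply: eq_bigr => i _; rewrite !mxE; ring.
Qed.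

Lemma normr_dot_le (r : nat) (u : 'rV[R]_r) (v : 'cV[R]_r) :
  `|(u *m v) 0 0| <= mx_norm u * norm1 v.
Proof.
rewrite mxE mulr_sumr; apply: le_trans (ler_norm_sum _ _ _) _.
apply: ler_sum => i _; rewrite normrM ler_wpM2r//.
by rewrite mx_normrE; apply/bigmax_geP; right; exists (0, i).
Qed.

(** On S, the decrease of the norm from theta to theta' is at most the mass of the
    error. Off S, theta' carries at least the mass of the error minus that of
    theta, so an error there increases the norm, unless theta has mass there. *)
Lemma norm1_decomposable (r : nat) (S : {set 'I_r}) (theta theta' : 'cV[R]_r) :
  norm1 (theta' - theta) + 2 * (norm1 theta - norm1 theta')
  <= 3 * (\sum_(i in S) `|(theta' - theta) i 0|)
     - \sum_(i | i \notin S) `|(theta' - theta) i 0|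
     + 4 * \sum_(i | i \notin S) `|theta i 0|.
Proof.
have on_S : \sum_(i in S) `|theta i 0| - \sum_(i in S) `|theta' i 0|
    <= \sum_(i in S) `|(theta' - theta) i 0|.
  rewrite -sumrB; apply: ler_sum => i _; rewrite !mxE distrC.
  exact: lerB_dist.
have off_S : \sum_(i | i \notin S) `|(theta' - theta) i 0|
    <= \sum_(i | i \notin S) `|theta i 0| + \sum_(i | i \notin S) `|theta' i 0|.
  rewrite -big_split; apply: ler_sum => i _; rewrite !mxE addrC /=.
  by rewrite -[X in _ <= X + _]normrN; exact: ler_normD.
rewrite /norm1 !(bigID (mem S) xpredT) /=.
lra.
Qed.

Lemma left_pinvK (r n : nat) (D : 'M[R]_(r, n)) :
  (forall x : 'cV_n, D *m x = 0 -> x = 0) -> left_pinv D *m D = 1%:M.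
Proof.
move=> D_inj; rewrite /left_pinv -mulmxA mulVmx// -row_free_unit.
apply: inj_row_free => x xDD0; apply: trmx_inj; rewrite trmx0; apply: D_inj.
(* x D^T D = 0 implies |D x^T|_2^2 = x D^T D x^T = 0 *)
have : norm2 (D *m x^T) ^+ 2 = 0.
  transitivity (((x *m (D^T *m D)) *m x^T) 0 0).
    rewrite sqr_norm2 mulmxA -mulmxA -[x *m D^T]trmxK trmx_mul trmxK mxE.
    by apply: eq_bigr => i _; rewrite [in RHS]mxE expr2.
  by rewrite xDD0 mul0mx mxE.
rewrite sqr_norm2 => /psumr_eq0P Dx0.
apply/colP => i; rewrite [RHS]mxE; apply/eqP; rewrite -sqrf_eq0.
by rewrite Dx0// => j _; exact: sqr_ge0.
Qed.

End Norms.

(** * The Lasso in analysis form *)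

(** Comparing the objective at bhat and at b leaves the cross term e^T X nu, which
    equals (e^T X Dp) (D nu) because Dp is a left inverse of D. Duality of the l1
    and max norms and the choice of lam bound it by half of N lam |D nu|_1. *)
Lemma analysis_lasso_basic (R : realType) (N n r : nat) (X : 'M[R]_(N, n))
    (D : 'M[R]_(r, n)) (Dp : 'M[R]_(n, r)) (e : 'cV[R]_N) (b bhat : 'cV[R]_n)
    (lam : R) :
  (0 < N)%N -> Dp *m D = 1%:M ->
  2 / N%:R * mx_norm (e^T *m X *m Dp) <= lam ->
  (2 * N%:R)^-1 * norm2 (X *m b + e - X *m bhat) ^+ 2 + lam * norm1 (D *m bhat)
    <= (2 * N%:R)^-1 * norm2 (X *m b + e - X *m b) ^+ 2
       + lam * norm1 (D *m b) ->
  N%:R^-1 * norm2 (X *m (bhat - b)) ^+ 2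
    <= lam * (norm1 (D *m bhat - D *m b)
              + 2 * (norm1 (D *m b) - norm1 (D *m bhat))).
Proof.
move=> N_gt0 DpK lam_noise.
have NR_gt0 : 0 < N%:R :> R by rewrite ltr0n.
have -> : X *m b + e - X *m b = e by rewrite addrAC subrr add0r.
have -> : X *m b + e - X *m bhat = e - X *m (bhat - b).
  by rewrite mulmxBr opprB addrA [e + _]addrC.
rewrite sqr_norm2B.
set M := mx_norm _ in lam_noise.
set v := norm1 (D *m bhat - D *m b); set P := norm2 (X *m _) ^+ 2.
set E := norm2 e ^+ 2; set c := (_ *m _) 0 0.
have c_le : c <= M * v.
  apply: le_trans (ler_norm _) _.
  have -> : c = (e^T *m X *m Dp *m (D *m bhat - D *m b)) 0 0.
    by rewrite -mulmxBr -(mulmxA _ Dp) (mulmxA Dp) DpK mul1mx -mulmxA.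
  exact: normr_dot_le.
have cross_le : 2 / N%:R * c <= lam * v.
  apply: (@le_trans _ _ (2 / N%:R * M * v)).
    by rewrite -[leRHS]mulrA ler_wpM2l// divr_ge0// ltW.
  by rewrite ler_wpM2r// norm1_ge0.
rewrite invfM => basic.
have -> : N%:R^-1 * P =
    2 * (2^-1 / N%:R * (E - 2 * c + P)) - 2 * (2^-1 / N%:R * E)
    + 2 / N%:R * c.
  by field; rewrite gt_eqF.
lra.
Qed.

(** With t = |v_S|_1, c = |v_S^c|_1, Q = |v|_2^2 and P the prediction error, the
    first hypothesis on P is the cone inequality and the second one is the
    curvature condition. *)
Lemma lasso_error_arith (R : realType) (lam eta' tau s a t c Q P I II : R) :
  0 < lam -> 0 < eta' -> 0 < tau -> 0 <= s -> 0 <= a -> 0 <= t -> 0 <= c ->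
  0 <= Q -> 0 <= P ->
  P <= lam * (3 * t - c + 4 * a) ->
  eta' * Q - tau * (t + c) ^+ 2 <= P ->
  t ^+ 2 <= s * Q ->
  64 * tau * s <= eta' ->
  I = 144 * lam ^+ 2 * s / eta' ^+ 2 ->
  II = 32 / eta' * (lam * a + 4 * tau * a ^+ 2) ->
  [/\ Q <= I + II,
      P <= 4 * (lam * a) + 3 * lam * Num.sqrt (s * (I + II))
    & (t + c) ^+ 2 <= 128 * a ^+ 2 + 128 * s * (I + II)].
Proof.
move=> lam_gt0 eta_gt0 tau_gt0 s_ge0 a_ge0 t_ge0 c_ge0 Q_ge0 P_ge0.
move=> cone curv tsQ taus -> ->; set B := _ + _.
have c_le : c <= 3 * t + 4 * a.
  by have := le_trans P_ge0 cone; rewrite pmulr_rge0//; lra.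
have tc_le : (t + c) ^+ 2 <= 32 * (s * Q) + 32 * a ^+ 2.
  have : (t + c) ^+ 2 <= (4 * t + 4 * a) ^+ 2 by rewrite ler_sqr ?nnegrE; lra.
  have := sqr_ge0 (t - a); nra.
have t_le : t <= Num.sqrt s * Num.sqrt Q.
  by rewrite -sqrtrM// -(ger0_norm t_ge0) -sqrtr_sqr ler_wsqrtr.
have P_le : P <= 3 * lam * t + 4 * (lam * a) by nra.
(* Young's inequality, from (eta' |v|_2 / 2 - 3 lam sqrt s)^2 >= 0 *)
have young : 3 * lam * t <= eta' / 4 * Q + 9 * lam ^+ 2 * s / eta'.
  rewrite -(ler_pM2l eta_gt0).
  have -> : eta' * (eta' / 4 * Q + 9 * lam ^+ 2 * s / eta') =
      eta' ^+ 2 / 4 * Q + 9 * lam ^+ 2 * s by field; rewrite gt_eqF.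
  have -> : eta' ^+ 2 / 4 * Q + 9 * lam ^+ 2 * s =
      (eta' / 2 * Num.sqrt Q - 3 * lam * Num.sqrt s) ^+ 2
      + 3 * (eta' * lam) * (Num.sqrt s * Num.sqrt Q).
    rewrite -[in LHS](sqr_sqrtr Q_ge0) -[in LHS](sqr_sqrtr s_ge0).
    by field.
  have : eta' * lam * t <= eta' * lam * (Num.sqrt s * Num.sqrt Q).
    by rewrite ler_wpM2l// mulr_ge0// ltW.
  have := sqr_ge0 (eta' / 2 * Num.sqrt Q - 3 * lam * Num.sqrt s).
  lra.
have absorb : tau * (t + c) ^+ 2 <= eta' / 2 * Q + 32 * tau * a ^+ 2.
  have : tau * (t + c) ^+ 2 <= tau * (32 * (s * Q) + 32 * a ^+ 2).
    by rewrite ler_wpM2l// ltW.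
  have : 64 * tau * s * Q <= eta' * Q by rewrite ler_wpM2r.
  lra.
have quarter : eta' / 4 * Q
    <= 9 * lam ^+ 2 * s / eta' + 4 * (lam * a) + 32 * tau * a ^+ 2 by lra.
have lamsq_ge0 : 0 <= lam ^+ 2 * s / eta'.
  by rewrite divr_ge0// ?mulr_ge0// ?sqr_ge0// ltW.
have la_ge0 : 0 <= lam * a by rewrite mulr_ge0// ltW.
have QB : Q <= B.
  rewrite -(@ler_pM2l _ (eta' / 4)) ?divr_gt0//.
  have -> : eta' / 4 * B = 36 * (lam ^+ 2 * s / eta')
      + 8 * (lam * a) + 32 * tau * a ^+ 2 by rewrite /B; field; rewrite gt_eqF.
  lra.
have sQB : s * Q <= s * B by rewrite ler_wpM2l.
have a2_ge0 := sqr_ge0 a.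
split=> //; last by rewrite -mulrA; nra.
have tB : t <= Num.sqrt (s * B).
  by rewrite -(ger0_norm t_ge0) -sqrtr_sqr ler_wsqrtr// (le_trans tsQ).
have : 3 * lam * t <= 3 * lam * Num.sqrt (s * B).
  by rewrite ler_wpM2l// mulr_ge0// ltW.
lra.
Qed.

(** * The graph Lasso *)

(** The two blocks of D have different thresholds and different exponents, so the
    active rows are selected block by block. *)
Definition active_set (r n : nat) (S1 : {set 'I_r}) (S2 : {set 'I_n}) :
    {set 'I_(r + n)} :=
  [set i | match fintype.split i with inl j => j \in S1 | inr j => j \in S2 end]%SET.

Lemma lshift_active (r n : nat) (S1 : {set 'I_r}) (S2 : {set 'I_n}) (i : 'I_r) :
  (lshift n i \in active_set S1 S2) = (i \in S1).
Proof. by rewrite inE (unsplitK (inl i)). Qed.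

Lemma rshift_active (r n : nat) (S1 : {set 'I_r}) (S2 : {set 'I_n}) (i : 'I_n) :
  (rshift r i \in active_set S1 S2) = (i \in S2).
Proof. by rewrite inE (unsplitK (inr i)). Qed.

Lemma card_active (r n : nat) (S1 : {set 'I_r}) (S2 : {set 'I_n}) :
  #|active_set S1 S2| = (#|S1| + #|S2|)%N.
Proof.
rewrite -!sum1_card big_split_ord /=.
by congr (_ + _)%N; apply: eq_bigl => i; rewrite (lshift_active, rshift_active).
Qed.

Lemma sum_inactive (R : realType) (r n : nat) (S1 : {set 'I_r})
    (S2 : {set 'I_n}) (u : 'cV[R]_r) (v : 'cV[R]_n) :
  \sum_(i | i \notin active_set S1 S2) `|col_mx u v i 0| =
  \sum_(i | i \notin S1) `|u i 0| + \sum_(i | i \notin S2) `|v i 0|.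
Proof.
rewrite big_split_ord /=; congr (_ + _).
  by apply: eq_big => i; rewrite ?lshift_active// col_mxEu.
by apply: eq_big => i; rewrite ?rshift_active// col_mxEd.
Qed.

Section StackedOperator.
Context (R : realType) (n : nat) (adj : rel 'I_n) (k : nat) (lamg lam : R).
Let D := stacked_op adj k lamg lam.

Lemma stacked_opE (b : 'cV[R]_n) :
  D *m b = col_mx ((lamg / lam) *: (gdiff R adj k *m b)) b.
Proof. by rewrite mul_col_mx -scalemxAl mul1mx. Qed.

Lemma left_pinv_stackedK : left_pinv D *m D = 1%:M.
Proof.
apply: left_pinvK => x; rewrite stacked_opE => Dx0.
by have := congr1 dsubmx Dx0; rewrite col_mxKd => ->; rewrite linear0.
Qed.

Lemma stacked_penalty (b : 'cV[R]_n) : 0 < lam -> 0 < lamg ->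
  lamg * norm1 (gdiff R adj k *m b) + lam * norm1 b = lam * norm1 (D *m b).
Proof.
move=> lam_gt0 lamg_gt0; rewrite stacked_opE norm1_col_mx norm1Z.
by rewrite gtr0_norm ?divr_gt0//; field; rewrite gt_eqF.
Qed.

End StackedOperator.

Theorem theorem3 (R : realType)
  (n : nat) (adj : rel 'I_n) (adj_sym : symmetric adj) (adj_irr : irreflexive adj)
  (k : nat) (q1 q2 R1 R2 : R)
  (hq1 : 0 < q1 < 1) (hq2 : 0 < q2 < 1) (hR1 : 0 < R1) (hR2 : 0 < R2)
  (N : nat) (hN : (0 < N)%N) (X : 'M[R]_(N, n))
  (betas : 'cV[R]_n) (hbetas : param_space adj k q1 q2 R1 R2 betas)
  (disp : measure_display) (T : measurableType disp) (P : probability T R)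
  (eps : 'I_N -> {RV P >-> R}) (sigma : R)
  (heps_indep : mutually_independent eps)
  (heps_id : identically_distributed eps)
  (heps_sg : forall i, sub_gaussian sigma (eps i))
  (y : T -> 'cV[R]_N)
  (hy : forall w, y w = X *m betas + noise_vector eps w)
  (lam lamg : R) (hlam : 0 < lam) (hlamg : 0 < lamg)
  (eta' tau : R) (heta' : 0 < eta') (htau : 0 < tau)
  (hRE : forall v : 'cV[R]_(gdiff_rows adj k + n),
     eta' * norm2 v ^+ 2 - tau * norm1 v ^+ 2
     <= N%:R^-1 * norm2 (X *m left_pinv (stacked_op adj k lamg lam) *m v) ^+ 2)
  (eta1 eta2 : R) (heta1 : 0 < eta1) (heta2 : 0 < eta2)
  (hscale : R1 * eta1 `^ (- q1) + R2 * eta2 `^ (- q2) <= eta' / (64 * tau))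
  (w : T)
  (hlam_noise : 2 / N%:R *
     mx_norm ((noise_vector eps w)^T *m X *m left_pinv (stacked_op adj k lamg lam))
     <= lam)
  (betahat : 'cV[R]_n) (hbetahat : is_gppl adj k X (y w) lamg lam betahat) :
  let I := 144 * lam ^+ 2 * (R1 * eta1 `^ (- q1) + R2 * eta2 `^ (- q2)) / eta' ^+ 2 in
  let II := 32 / eta' *
    (lamg * R1 * eta1 `^ (1 - q1) + lam * R2 * eta2 `^ (1 - q2)
     + 4 * tau * (lamg / lam * R1 * eta1 `^ (1 - q1) + R2 * eta2 `^ (1 - q2)) ^+ 2) in
  [/\ norm2 (betahat - betas) ^+ 2 <= I + II,
      N%:R^-1 * norm2 (X *m (betahat - betas)) ^+ 2
      <= 4 * (lamg * R1 * eta1 `^ (1 - q1) + lam * R2 * eta2 `^ (1 - q2))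
         + 3 * lam * Num.sqrt ((R1 * eta1 `^ (- q1) + R2 * eta2 `^ (- q2)) * (I + II))
    & lamg = 2 `^ (- (1 + k%:R / 2)) * (max_degree adj)%:R `^ (- ((k%:R + 1) / 2)) * lam ->
      norm1 (betahat - betas) ^+ 2
      <= 128 * (lamg / lam * R1 * eta1 `^ (1 - q1) + R2 * eta2 `^ (1 - q2)) ^+ 2
         + 128 * (R1 * eta1 `^ (- q1) + R2 * eta2 `^ (- q2)) * (I + II)].
Proof.
move=> I II.
pose S1 := above eta1 (fun i => (row i (gdiff R adj k) *m betas) 0 0).
pose S2 := above eta2 (fun i => betas i 0).
pose S := active_set S1 S2.
pose s := R1 * eta1 `^ (- q1) + R2 * eta2 `^ (- q2).
pose a := lamg / lam * R1 * eta1 `^ (1 - q1) + R2 * eta2 `^ (1 - q2).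
pose D := stacked_op adj k lamg lam.
pose v := D *m betahat - D *m betas.
have [beta_g beta_1] := hbetas.
have rowE i : (row i (gdiff R adj k) *m betas) 0 0 = (gdiff R adj k *m betas) i 0.
  by rewrite -row_mul mxE.
have gamma_gt0 : 0 < lamg / lam by rewrite divr_gt0.
have card_S : #|S|%:R <= s.
  by rewrite card_active natrD lerD//; exact: card_above.
have mass_S : \sum_(i | i \notin S) `|(D *m betas) i 0| <= a.
  rewrite stacked_opE sum_inactive; apply: lerD; last exact: sum_below.
  rewrite -!mulrA mulrA.
  apply: le_trans
    (ler_wpM2l (ltW gamma_gt0) (sum_below hq1 heta1 beta_g)).
  rewrite mulr_sumr; apply: ler_sum => i _.
  by rewrite rowE mxE normrM gtr0_norm.
(* a is in the units of D beta, where the l1 penalty has the single weight lam *)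
have lam_a : lamg * R1 * eta1 `^ (1 - q1) + lam * R2 * eta2 `^ (1 - q2) = lam * a.
  by rewrite /a; field; rewrite gt_eqF.
have vE : v = col_mx ((lamg / lam) *: (gdiff R adj k *m (betahat - betas)))
                     (betahat - betas).
  by rewrite /v -mulmxBr stacked_opE.
have XvE : X *m left_pinv D *m v = X *m (betahat - betas).
  by rewrite /v -mulmxBr -mulmxA (mulmxA _ D) left_pinv_stackedK mul1mx.
have basic : N%:R^-1 * norm2 (X *m (betahat - betas)) ^+ 2
    <= lam * (norm1 v + 2 * (norm1 (D *m betas) - norm1 (D *m betahat))).
  apply: (analysis_lasso_basic hN (left_pinv_stackedK _ _ _ _) hlam_noise).
  have := hbetahat betas; rewrite /gppl_objective hy.
  by rewrite -!addrA !stacked_penalty.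
set t := \sum_(i in S) `|v i 0|; set c := \sum_(i | i \notin S) `|v i 0|.
have norm1v : norm1 v = t + c by rewrite /norm1 (bigID (mem S)).
have cone : N%:R^-1 * norm2 (X *m (betahat - betas)) ^+ 2
    <= lam * (3 * t - c + 4 * a).
  apply: le_trans basic _; rewrite ler_wpM2l ?(ltW hlam)//.
  apply: le_trans (norm1_decomposable S _ _) _.
  by rewrite lerD2l ler_wpM2l.
have curv := hRE v; rewrite XvE norm1v in curv.
have tQ : t ^+ 2 <= s * norm2 v ^+ 2.
  apply: le_trans (sqr_sum_le_card _ _) _.
  apply: ler_pM => //; first by apply: sumr_ge0 => i _; exact: sqr_ge0.
  rewrite sqr_norm2 [leRHS](bigID (mem S)) /= -[leLHS]addr0 lerD//.
    by rewrite ler_sum// => i _; rewrite real_normK ?num_real.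
  by apply: sumr_ge0 => i _; exact: sqr_ge0.
have taus : 64 * tau * s <= eta'.
  by rewrite mulrC -ler_pdivlMr// mulr_gt0.
have [] := @lasso_error_arith R lam eta' tau s a t c (norm2 v ^+ 2)
  (N%:R^-1 * norm2 (X *m (betahat - betas)) ^+ 2) I II => //.
- by apply: le_trans card_S.
- by apply: le_trans mass_S; exact: sumr_ge0.
- by apply: sumr_ge0.
- by apply: sumr_ge0.
- exact: sqr_ge0.
- by rewrite mulr_ge0// ?invr_ge0// sqr_ge0.
- by rewrite /II -lam_a.
move=> vI_II pred l1; split.
- by apply: le_trans vI_II; rewrite vE sqr_norm2_col_mx lerDr sqr_ge0.
- by rewrite lam_a.
- move=> _; apply: le_trans l1; rewrite -norm1v vE norm1_col_mx.
  by rewrite ler_sqr ?nnegrE ?addr_ge0 ?norm1_ge0// lerDr norm1_ge0.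
Qed.
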